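(* Disconnected fibers exist; that is, there exist an architecture $(n_0,\ldots,n_m)$ and a function $f\in\mathcal{M}_{n_0,\ldots,n_m}$ such that the fiber $\rho^{-1}(f)$ is a disconnected subset of $\mathcal{P}_{n_0,\ldots,n_m}$.
   Context: An architecture is a tuple $(n_0,\ldots,n_m)$ of positive integers with $m\ge 1$. Let $\sigma$ denote the map applying $t\mapsto\max\{0,t\}$ to each coordinate of a vector in any $\mathbb{R}^n$. Put $D(n_0,\ldots,n_m)=\sum_{i=1}^m n_i(n_{i-1}+1)$ and $\mathcal{P}_{n_0,\ldots,n_m}=\mathbb{R}^{D(n_0,\ldots,n_m)}$ (parameter space, with its Euclidean topology). A parameter $\theta\in\mathcal{P}_{n_0,\ldots,n_m}$ is identified with a list of matrices $[A^i]$ of size $n_i\times(n_{i-1}+1)$, $1\le i\le m$, giving affine maps $A^i:\mathbb{R}^{n_{i-1}}\to\mathbb{R}^{n_i}$, $A^i(x)=[A^i][x,1]^T$. The realization map $\rho:\mathcal{P}_{n_0,\ldots,n_m}\to C(\mathbb{R}^{n_0},\mathbb{R}^{n_m})$ sends $\theta$ to the function $\rho(\theta)=\sigma\circ A^m\circ\cdots\circ\sigma\circ A^1$. The moduli space $\mathcal{M}_{n_0,\ldots,n_m}$ is the image of $\rho$, and for $f\in\mathcal{M}_{n_0,\ldots,n_m}$ the fiber of $f$ is $\rho^{-1}(f)$. A subset $X$ of a topological space $Y$ is disconnected if there are disjoint open subsets $A,B$ of $Y$ with $X\subset A\cup B$, $A\cap X\neq\emptyset$ and $B\cap X\neq\emptyset$.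 *)

(* Defs.v *)
From HB Require Import structures.
From mathcomp Require Import all_boot all_order all_algebra.
From mathcomp Require Import all_classical all_reals all_analysis.
Set Implicit Arguments.
Unset Strict Implicit.
Unset Printing Implicit Defensive.
Import Order.TTheory GRing.Theory Num.Theory.
Import numFieldNormedType.Exports.
Local Open Scope classical_set_scope.
Local Open Scope ring_scope.

(* A tuple (n_0, ..., n_m) is represented by n0 = n_0 and
   ns = [:: n_1; ...; n_m], so that m = size ns. *)
Definition is_architecture (n0 : nat) (ns : seq nat) : Prop :=
  (1 <= size ns)%N /\ all (fun n => 0 < n)%N (n0 :: ns).

Fixpoint param_dim (n0 : nat) (ns : seq nat) : nat :=
  if ns is n1 :: ns' then (n1 * (n0 + 1) + param_dim n1 ns')%N else 0%N.

Lemma param_dimE (n0 : nat) (ns : seq nat) :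
  param_dim n0 ns =
  (\sum_(1 <= i < (size ns).+1)
     nth 0 (n0 :: ns) i * (nth 0 (n0 :: ns) i.-1 + 1))%N.
Proof.
elim: ns n0 => [|n1 ns IH] n0 /=; first by rewrite big_nil.
by rewrite IH big_add1 /= [RHS]big_add1 /= big_nat_recl.
Qed.

(* The canonical topology on row vectors is that of the sup norm, which is
   the Euclidean one. *)
Notation param_space R n0 ns := 'rV[R]_(param_dim n0 ns).

Section Network.
Variable R : realType.

Definition relu (n : nat) (x : 'cV[R]_n) : 'cV[R]_n := map_mx (Num.max 0) x.

Definition affine (k n : nat) (A : 'M[R]_(n, k + 1)) (x : 'cV[R]_k) : 'cV[R]_n :=
  A *m col_mx x (const_mx 1).

(* The first n1 * (n0 + 1) coordinates are the entries of the first matrix,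
   row by row; the remaining ones parametrize the later layers. *)
Fixpoint realization (n0 : nat) (ns : seq nat) :
    param_space R n0 ns -> 'cV[R]_n0 -> 'cV[R]_(last n0 ns) :=
  match ns with
  | [::] => fun _ x => x
  | n1 :: ns' => fun theta x =>
      realization (rsubmx theta) (relu (affine (vec_mx (lsubmx theta)) x))
  end.

Lemma continuous_mx (T : topologicalType) (m n : nat) (f : T -> 'M[R]_(m, n)) :
  (forall i j, continuous (fun x => f x i j)) -> continuous f.
Proof.
move=> cf x B [P Px PB].
have : \forall y \near x, forall i j, P i j (f y i j).
  apply: filter_forall => i; apply: filter_forall => j.
  exact: (cf i j x _ (Px i j)).
by apply: filterS => y; exact: PB.
Qed.

Lemma continuous_layer (k n : nat) (A : 'M[R]_(n, k + 1)) :
  continuous (fun x => relu (affine A x)).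
Proof.
apply: continuous_mx => i j.
have -> : (fun x => relu (affine A x) i j) =
    (fun x => Num.max 0 (\sum_l A i l * col_mx x (const_mx 1) l j)).
  by apply/funext => x; rewrite !mxE.
move=> x; apply: (@continuous_max R _ (cst 0)); first exact: cst_continuous.
rewrite /continuous_at; apply: (@cvg_big _ _ _ _ _ _ _ (nbhs x)) => [|l _].
  exact: add_continuous.
apply: cvgM; first exact: cvg_cst.
case: (split_ordP l) => l' ->.
  under eq_fun do rewrite col_mxEu.
  by rewrite col_mxEu; exact: coord_continuous.
by under eq_fun do rewrite col_mxEd mxE; rewrite col_mxEd mxE; exact: cvg_cst.
Qed.

Lemma continuous_realization (n0 : nat) (ns : seq nat)
  (theta : param_space R n0 ns) : continuous (realization theta).
Proof.
elim: ns n0 theta => [|n1 ns IH] n0 theta /= x; first exact: cvg_id.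
exact: (continuous_comp (@continuous_layer _ _ _ x) (IH n1 _ _)).
Qed.

Definition rho (n0 : nat) (ns : seq nat) (theta : param_space R n0 ns) :
  continuousType 'cV[R]_n0 'cV[R]_(last n0 ns) :=
  mkcts (@continuous_realization n0 ns theta).

Definition moduli_space (n0 : nat) (ns : seq nat) :
    set (continuousType 'cV[R]_n0 'cV[R]_(last n0 ns)) :=
  range (@rho n0 ns).

Definition fiber (n0 : nat) (ns : seq nat)
    (f : continuousType 'cV[R]_n0 'cV[R]_(last n0 ns)) :
    set (param_space R n0 ns) :=
  @rho n0 ns @^-1` [set f].

End Network.

Arguments rho {R} n0 ns theta.
Arguments moduli_space R n0 ns _ : clear implicits.
Arguments fiber {R} n0 ns f _.

Definition disconnected (Y : topologicalType) (X : set Y) : Prop :=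
  exists A B : set Y,
    [/\ open A, open B & A `&` B = set0] /\
    [/\ X `<=` A `|` B, A `&` X !=set0 & B `&` X !=set0].

(* Main.v *)
(** In the architecture (1, 2, 1), take f(x) = 1 + max(0, x) + max(0, x - 1).
    As f > 0, the output ReLU is inactive on the whole fiber. If the two hidden
    biases were equal to some b, the function before the output ReLU would be
    affine near 0 when b <> 0, and affine on [0, +oo[ when b = 0; the kinks of
    f at 0 and 1 exclude both. So the open sets of parameters where the first
    bias is smaller, resp. larger, than the second cover the fiber, and
    exchanging the two hidden neurons shows that both of them meet it. *)
Require Import Defs.
From mathcomp Require Import all_boot all_order all_algebra.
From mathcomp Require Import all_classical all_reals all_analysis.
From mathcomp Require Import lra.
Import Order.TTheory GRing.Theory Num.Theory.
Import numFieldNormedType.Exports.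
Local Open Scope classical_set_scope.
Local Open Scope ring_scope.

(** Neither [b + u] nor [b - u] crosses 0 to the side opposite to [b], and [Num.max 0] is linear on
    each side. *)
Lemma maxr_midpoint (R : realDomainType) (u b : R) :
  `|u| <= `|b| -> Num.max 0 (b + u) + Num.max 0 (b - u) = 2 * Num.max 0 b.
Proof.
case: (leP 0 b) => b0; [rewrite (ger0_norm b0) | rewrite (ltr0_norm b0)];
  rewrite ler_norml => /andP[h1 h2]; do ! case: leP => ?; lra.
Qed.

Lemma affineE (R : realType) (k n : nat) (A : 'M[R]_(n, k + 1)) (x : 'cV[R]_k) i j :
  affine A x i j = \sum_(l < k) A i (lshift 1 l) * x l j + A i (rshift k ord0).
Proof.
rewrite /affine mxE big_split_ord big_ord1 col_mxEd [const_mx 1 _ _]mxE mulr1.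
by congr (_ + _); apply: eq_bigr => l _; rewrite col_mxEu.
Qed.

Section TwoNeurons.
Variable R : realType.
Implicit Types (theta : param_space R 1 [:: 2; 1]) (i : 'I_2).

Definition hidden_layer theta : 'M[R]_(2, 1 + 1) := vec_mx (lsubmx theta).

Definition output_layer theta : 'M[R]_(1, 2 + 1) := vec_mx (lsubmx (rsubmx theta)).

Definition hidden_weight theta i : R := hidden_layer theta i (lshift 1 ord0).
Definition hidden_bias theta i : R := hidden_layer theta i (rshift 1 ord0).
Definition output_weight theta i : R := output_layer theta ord0 (lshift 1 i).
Definition output_bias theta : R := output_layer theta ord0 (rshift 2 ord0).

Definition preoutput theta (x : R) : R :=
  \sum_(i < 2) output_weight theta i *
     Num.max 0 (hidden_weight theta i * x + hidden_bias theta i)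
  + output_bias theta.

Lemma rhoE theta (x : 'cV[R]_1) :
  rho 1 [:: 2; 1] theta x = const_mx (Num.max 0 (preoutput theta (x ord0 ord0))).
Proof.
have -> : rho 1 [:: 2; 1] theta x =
    relu (affine (output_layer theta) (relu (affine (hidden_layer theta) x))) by [].
apply/matrixP => i j; rewrite [i]ord1 [j]ord1 /relu mxE [RHS]mxE affineE.
congr (Num.max 0 (_ + _)); apply: eq_bigr => k _.
by rewrite [map_mx _ _ _ _]mxE affineE big_ord1.
Qed.

Lemma continuous_hidden_bias i : continuous (fun theta => hidden_bias theta i).
Proof.
rewrite /hidden_bias /hidden_layer.
under eq_fun do rewrite !mxE.
exact: coord_continuous.
Qed.

(** On a small interval around 0 no hidden neuron switches between active and inactive, so
    [preoutput theta] is affine there. *)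
Lemma preoutput_midpoint theta b : b != 0 -> (forall i, hidden_bias theta i = b) ->
  exists2 e, 0 < e & preoutput theta e + preoutput theta (- e) = 2 * preoutput theta 0.
Proof.
(* [M] bounds every hidden weight in absolute value, and the summand 1 keeps it positive; with [e]
   equal to [|b| / M], each weight times [e] is at most [|b|] in absolute value. *)
move=> b0 thetab; set M := 1 + \sum_(i < 2) `|hidden_weight theta i|.
have M0 : 0 < M by rewrite ltr_pwDl// sumr_ge0.
exists (`|b| / M); first by rewrite divr_gt0// normr_gt0.
rewrite /preoutput addrACA -big_split /= mulrDr mulr_sumr -mulr2n mulr_natl.
congr (_ + _); apply: eq_bigr => i _; rewrite thetab mulr0 add0r -mulrDr.
rewrite [LHS](_ : _ = output_weight theta i * (2 * Num.max 0 b)); last first.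
  congr (_ * _); rewrite mulrN ![_ + b]addrC maxr_midpoint//.
  rewrite normrM normf_div normr_id (gtr0_norm M0) mulrA ler_pdivrMr// mulrC ler_wpM2l//.
  by rewrite /M (bigD1 i)//= addrCA lerDl addr_ge0// sumr_ge0.
by rewrite mulrCA.
Qed.

(** ReLU commutes with multiplication by [t >= 0], so without hidden biases only the output bias
    breaks homogeneity. *)
Lemma preoutput_homogeneous theta t x : 0 <= t -> (forall i, hidden_bias theta i = 0) ->
  preoutput theta (t * x) - output_bias theta
  = t * (preoutput theta x - output_bias theta).
Proof.
move=> t0 thetab; rewrite /preoutput !addrK mulr_sumr; apply: eq_bigr => i _.
by rewrite thetab !addr0 mulrCA -{1}(mulr0 t) -maxr_pMr// mulrCA.
Qed.

(** The output bias is also 1, which keeps the preoutput positive. The final [0] is the empty row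
    left after the last layer. *)
Definition unit_weights (b : 'I_2 -> R) : param_space R 1 [:: 2; 1] :=
  row_mx (mxvec (row_mx (const_mx 1) (\col_i b i) : 'M[R]_(2, 1 + 1)))
    (row_mx (mxvec (const_mx 1 : 'M[R]_(1, 2 + 1))) 0).

Lemma hidden_bias_unit_weights b i : hidden_bias (unit_weights b) i = b i.
Proof.
by rewrite /hidden_bias /hidden_layer row_mxKl mxvecK row_mxEr mxE.
Qed.

Lemma preoutput_unit_weights b x :
  preoutput (unit_weights b) x = \sum_(i < 2) Num.max 0 (x + b i) + 1.
Proof.
rewrite /preoutput /output_bias /output_weight /hidden_weight.
rewrite /output_layer row_mxKr row_mxKl mxvecK mxE.
congr (_ + _); apply: eq_bigr => i _.
rewrite hidden_bias_unit_weights /hidden_layer row_mxKl mxvecK row_mxEl !mxE.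
by rewrite !mul1r.
Qed.

(** Neuron [i] has its kink at [i]. As all weights agree, reversing the biases in [kinks10] amounts
    to exchanging the neurons. *)
Definition kinks01 := unit_weights (fun i => - i%:R).
Definition kinks10 := unit_weights (fun i => - (rev_ord i)%:R).

Lemma rho_kinks10 : rho 1 [:: 2; 1] kinks10 = rho 1 [:: 2; 1] kinks01.
Proof.
apply/continuousEP => x; rewrite !rhoE !preoutput_unit_weights.
by rewrite [in RHS](reindex_inj rev_ord_inj).
Qed.

Lemma fiber_kinks01_preoutput theta x :
  fiber 1 [:: 2; 1] (rho 1 [:: 2; 1] kinks01) theta ->
  preoutput theta x = Num.max 0 x + Num.max 0 (x - 1) + 1.
Proof.
move=> /(congr1 (fun f : continuousType 'cV[R]_1 'cV[R]_1 => f (const_mx x) ord0 ord0)).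
rewrite !rhoE !mxE preoutput_unit_weights big_ord_recl big_ord1 /= subr0.
rewrite -[(bump 0 0)%:R]/(1 : R).
(* The value of the target function is at least 1, so a negative preoutput, which ReLU sends to 0,
   is impossible. *)
by case: (leP 0 x) => ?; case: (leP 0 (x - 1)) => ?; do ! case: leP => ?; lra.
Qed.

Lemma fiber_kinks01_biases theta :
  fiber 1 [:: 2; 1] (rho 1 [:: 2; 1] kinks01) theta ->
  hidden_bias theta ord0 != hidden_bias theta ord_max.
Proof.
move=> fib; apply/eqP => b01.
have thetab i : hidden_bias theta i = hidden_bias theta ord0.
  case: (unliftP ord0 i) => [j|] -> //; rewrite b01 ord1.
  by congr hidden_bias; exact: val_inj.
have preoutputE x := fiber_kinks01_preoutput theta x fib.
have left_of_0 x : x <= 0 -> preoutput theta x = 1.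
  by move=> x0; rewrite preoutputE !max_l //; lra.
have [b0|b0] := eqVneq (hidden_bias theta ord0) 0.
  have right_of_1 x : 1 <= x -> preoutput theta x = 2 * x.
    by move=> x1; rewrite preoutputE !max_r //; lra.
  (* Scaling the point 1 by 0 shows that the output bias is 1; scaling it by 2 then gives 4 - 1 = 2
     * (2 - 1), which is absurd. *)
  have h t : 0 <= t -> _ := fun t0 =>
    preoutput_homogeneous theta t 1 t0 (fun i => etrans (thetab i) b0).
  have := h 0 (lexx _); have := h 2 (ler0n _ _).
  rewrite mul0r mulr1 (left_of_0 0) // (right_of_1 1) // (right_of_1 2); lra.
have [e e0] := preoutput_midpoint theta _ b0 thetab.
(* The preoutput is 1 at 0 and at [- e], so the midpoint identity would force the value 1 at [e]
   too. *)
have : e + 1 <= preoutput theta e.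
  by rewrite preoutputE lerD2r (max_r (ltW e0)) lerDl le_max lexx.
by rewrite (left_of_0 0) // (left_of_0 (- e)) ?oppr_le0 ?(ltW e0) //; lra.
Qed.

Lemma open_hidden_bias_lt i j :
  open [set theta | hidden_bias theta i < hidden_bias theta j].
Proof.
have -> : [set theta | hidden_bias theta i < hidden_bias theta j] =
    (fun theta => hidden_bias theta j - hidden_bias theta i) @^-1` [set x | 0 < x].
  by apply/seteqP; split=> theta /=; rewrite subr_gt0.
apply: open_comp => [theta _|]; last exact: open_gt.
by apply: continuousB; exact: continuous_hidden_bias.
Qed.

End TwoNeurons.

Theorem proposition11p8 (R : realType) :
  exists (n0 : nat) (ns : seq nat), is_architecture n0 ns /\
  exists f : continuousType 'cV[R]_n0 'cV[R]_(last n0 ns),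
    moduli_space R n0 ns f /\ disconnected (fiber n0 ns f).
Proof.
exists 1%N, [:: 2; 1]%N; split=> //.
exists (rho 1 [:: 2; 1]%N (kinks01 R)); split; first by exists (kinks01 R).
exists [set theta | hidden_bias R theta ord_max < hidden_bias R theta ord0].
exists [set theta | hidden_bias R theta ord0 < hidden_bias R theta ord_max].
split; split.
- exact: open_hidden_bias_lt.
- exact: open_hidden_bias_lt.
- by apply/seteqP; split=> theta //= [h1 h2]; have := lt_trans h1 h2; rewrite ltxx.
- by move=> theta /fiber_kinks01_biases; rewrite neq_lt => /orP[]; [right|left].
(* The hidden biases are 0 and -1 for [kinks01], and -1 and 0 for [kinks10]. *)
- exists (kinks01 R); split=> //=.
  by rewrite !hidden_bias_unit_weights /= oppr0 ltrN10.
- exists (kinks10 R); split; last exact: rho_kinks10.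
  by rewrite /= !hidden_bias_unit_weights /= oppr0 ltrN10.
Qed.
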